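(* Let $\mathcal{A}$ be a unital $C^*$-algebra, $a\in \mathcal{A}$ and $f\in S(\mathcal{A})$. Then $$|f(a)|^2 \leq \frac14 \big|f(|a|+ i |a^*|)\big|^2+ \frac14 \big|f(|a||a^*|)\big|+ \frac18 f(|a|^2 +|a^*|^2).$$ Moreover, $$v^{2}(a) \leq \frac14 v^2(|a|+i|a^*|) +\frac14 v(|a||a^*|)+ \frac18 \left\| |a|^2+|a^*|^2 \right\|.$$
   Context: $\mathcal{A}$ is a unital $C^*$-algebra with unit $e$. $S(\mathcal{A})$ is the set of normalized states, i.e. continuous linear functionals $f$ on $\mathcal{A}$ with $f(e)=\|f\|=1$ (equivalently, positive linear functionals with $f(e)=1$). The algebraic numerical radius of $a$ is $v(a)=\sup\{|f(a)|: f\in S(\mathcal{A})\}$, and $v^2(a)$ means $(v(a))^2$. $|a|=(a^*a)^{1/2}$, so $|a^*|=(aa^* )^{1/2}$. $i=\sqrt{-1}$. *)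

(* Defs.v *)
From HB Require Import structures.
From mathcomp Require Import all_boot all_order all_algebra.
From mathcomp Require Import all_classical all_reals all_analysis.
From mathcomp Require Export complex.

Set Implicit Arguments.
Unset Strict Implicit.
Unset Printing Implicit Defensive.

Import Order.TTheory GRing.Theory Num.Theory.
Import numFieldNormedType.Exports.

Local Open Scope classical_set_scope.
Local Open Scope complex_scope.
Local Open Scope ring_scope.

(* Unital complex C*-algebras.  As for every normedModType over R[i], the norm
   takes its values in R[i], where it is a nonnegative real.  HB rejects a join
   of normed modules with rings (it would have to precede numDomainType), so the
   mixin carries the product, from which the ring structure on A is derived
   below.  That structure is a pzRingType rather than an algType, since the
   latter excludes the zero algebra. *)
HB.mixin Record isCStarAlgebra (R : realType) A
    of CompleteNormedModule R[i] A := {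
  cstar_one : A;
  cstar_mul : A -> A -> A;
  star : A -> A;
  cstar_mulA : associative cstar_mul;
  cstar_mul1x : left_id cstar_one cstar_mul;
  cstar_mulx1 : right_id cstar_one cstar_mul;
  cstar_mulDl : left_distributive cstar_mul +%R;
  cstar_mulDr : right_distributive cstar_mul +%R;
  cstar_scaleAl : forall (c : R[i]) (x y : A),
    c *: cstar_mul x y = cstar_mul (c *: x) y;
  cstar_scaleAr : forall (c : R[i]) (x y : A),
    c *: cstar_mul x y = cstar_mul x (c *: y);
  cstar_normM : forall x y : A, `|cstar_mul x y| <= `|x| * `|y|;
  starK : involutive star;
  starD : {morph star : x y / x + y};
  starZ : forall (c : R[i]) (x : A), star (c *: x) = c^* *: star x;
  cstar_starM : forall x y : A,
    star (cstar_mul x y) = cstar_mul (star y) (star x);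
  cstar_norm_starM : forall x : A, `|cstar_mul (star x) x| = `|x| ^+ 2
}.

#[short(type="cstarAlgType")]
HB.structure Definition CStarAlgebra (R : realType) :=
  {A of isCStarAlgebra R A & CompleteNormedModule R[i] A}.

HB.instance Definition _ (R : realType) (A : cstarAlgType R) :=
  GRing.Zmodule_isPzRing.Build A
    (@cstar_mulA R A) (@cstar_mul1x R A) (@cstar_mulx1 R A)
    (@cstar_mulDl R A) (@cstar_mulDr R A).

Section CStarTheory.
Variables (R : realType) (A : cstarAlgType R).
Implicit Types (a b : A) (f : {linear A -> R[i]^o}).

Definition invertible a := exists b, a * b = 1 /\ b * a = 1.

Definition spectrum a : set R[i] :=
  [set l : R[i] | ~ invertible (a - l *: (1 : A))].

(* In R[i], [0 <= l] says that l is real and nonnegative. *)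
Definition positive a :=
  star a = a /\ spectrum a `<=` [set l : R[i] | 0 <= l].

(* The positive square root: for positive [a] it exists and is unique, so the
   choice is immaterial; 0 is the default value when there is none. *)
Definition pos_sqrt a : A := xget 0 [set b | positive b /\ b ^+ 2 = a].

Definition modulus a : A := pos_sqrt (star a * a).

Definition real_norm (V : normedModType R[i]) (x : V) : R := complex.Re `|x|.

(* Finite as soon as [f] is continuous. *)
Definition dual_norm f : R :=
  sup [set real_norm (f x) | x in [set x : A | `|x| <= 1]].

Definition states : set {linear A -> R[i]^o} :=
  [set f : {linear A -> R[i]^o} | [/\ continuous f, f 1 = 1 & dual_norm f = 1]].

Definition numerical_radius a : R := sup [set real_norm (f a) | f in states].

End CStarTheory.

(* Main.v *)
Require Import Defs.
From mathcomp Require Import all_boot all_order all_algebra.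
From mathcomp Require Import all_classical all_reals all_analysis.
From mathcomp Require Import complex ring lra.

(* With [b = |a|], [c = |a^*|] and a state [f], the mixed Schwarz inequality
   gives [|f(a)|^2 <= f(b) f(c)].  Half of [f(b) f(c)] is at most
   [(f(b)^2 + f(c)^2) / 4 = |f(b + i c)|^2 / 4], and by Buzano's inequality the
   other half is at most [|f(b c)| / 4 + f(b^2 + c^2) / 8].

   Functional calculus and the spectral radius formula are avoided by working
   with the closed convex cone of the self-adjoint [b] such that [|t - b| <= t]
   for some [t > 0].  Its elements have square roots, obtained by iterating
   [y -> (x + y^2) / 2], and it contains all squares of self-adjoint elements
   because [c + i s] is a multiple of a unitary when [c^2 + s^2] is a scalar.
   From this one gets that [x^* x] lies in the cone, and that the cone is the
   set of self-adjoint elements with nonnegative spectrum.  The mixed Schwarz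
   inequality follows from Cauchy-Schwarz and [a |a| = |a^*| a]. *)

Set Implicit Arguments.
Unset Strict Implicit.
Unset Printing Implicit Defensive.

Import Order.TTheory GRing.Theory Num.Theory.
Import numFieldNormedType.Exports.
Local Open Scope classical_set_scope.
Local Open Scope ring_scope.

(** * Real-valued norms on complex normed modules *)

Section NormedModule.
Variables (R : realType) (V : normedModType R[i]).
Implicit Types (x y : V) (t : R) (l : R[i]).

Local Notation N := real_norm.

Lemma real_normE x : `|x| = (N x)%:C%C.
Proof. by rewrite RRe_real // normr_real. Qed.

Lemma real_norm_leC x t : (`|x| <= t%:C%C) = (N x <= t).
Proof. by rewrite real_normE lecR. Qed.

Lemma real_norm_ge0 x : 0 <= N x.
Proof. by rewrite -ler0c -real_normE. Qed.

Lemma real_norm0 : N (0 : V) = 0.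
Proof. by rewrite /real_norm normr0. Qed.

Lemma real_norm_eq0 x : N x = 0 -> x = 0.
Proof. by move=> x0; apply/eqP; rewrite -normr_eq0 real_normE x0. Qed.

Lemma real_normN x : N (- x) = N x.
Proof. by rewrite /real_norm normrN. Qed.

Lemma real_distrC x y : N (x - y) = N (y - x).
Proof. by rewrite -real_normN opprB. Qed.

Lemma ler_real_normD x y : N (x + y) <= N x + N y.
Proof. by rewrite -real_norm_leC rmorphD /= -!real_normE ler_normD. Qed.

Lemma ler_real_normB x y : N (x - y) <= N x + N y.
Proof. by rewrite -(real_normN y) ler_real_normD. Qed.

Lemma real_normZ l x : N (l *: x) = complex.Re `|l| * N x.
Proof.
apply: complexI; rewrite rmorphM /= RRe_real ?normr_real //.
by rewrite -!real_normE normrZ.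
Qed.

Lemma real_normZr t x : N (t%:C%C *: x) = `|t| * N x.
Proof. by rewrite real_normZ normc_def /= expr0n addr0 sqrtr_sqr. Qed.

Lemma real_norm_small0 (C : R) x : (forall e, 0 < e -> N x <= C * e) -> x = 0.
Proof.
move=> h; apply: real_norm_eq0; apply/eqP; rewrite eq_le real_norm_ge0 andbT.
apply/ler_addgt0Pr => e e0; rewrite add0r.
have C1 : 0 < `|C| + 1 by rewrite ltr_wpDl.
apply: (le_trans (h (e / (`|C| + 1)) _)); first by rewrite divr_gt0.
rewrite mulrA ler_pdivrMr // mulrC ler_wpM2l ?(ltW e0) //.
by apply: (le_trans (ler_norm C)); rewrite lerDl.
Qed.

End NormedModule.

(** * Convergence by scalar domination *)

Section Limits.
Variables (R : realType) (V : completeNormedModType R[i]).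
Local Notation N := real_norm.

(** [eta] is nondecreasing and bounded, hence Cauchy, and by telescoping it controls the distances
    between the terms of [u]. Starting both at 0 gives the bound on the limit. *)
Lemma dominated_increments_cvg {u : nat -> V} {eta : nat -> R} (L : R) :
  u 0%N = 0 -> eta 0%N = 0 ->
  (forall n, N (u n.+1 - u n) <= eta n.+1 - eta n) -> (forall n, eta n <= L) ->
  exists2 l : V, N l <= L &
    forall e : R, 0 < e -> exists n0, forall n, (n0 <= n)%N -> N (u n - l) <= e.
Proof.
move=> u0 eta0 hu hL.
have inc n k : N (u (n + k)%N - u n) <= eta (n + k)%N - eta n.
  elim: k => [|k IH]; first by rewrite addn0 !subrr real_norm0.
  rewrite addnS; have := ler_real_normD (u (n + k).+1 - u (n + k)%N) (u (n + k)%N - u n).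
  by rewrite addrA subrK; have := hu (n + k)%N; lra.
have inc_le n k : (n <= k)%N -> N (u k - u n) <= eta k - eta n.
  by move=> nk; have := inc n (k - n)%N; rewrite subnKC.
pose S := sup (range eta).
have hS : has_sup (range eta).
  by split; [exists (eta 0%N); exists 0%N | exists L => _ [n _ <-]].
have leS n : eta n <= S by apply: sup_upper_bound => //; exists n.
have close e : 0 < e -> exists n0, forall n k, (n0 <= n)%N -> (n <= k)%N -> N (u k - u n) < e.
  move=> e0; have [_ [n0 _ <-] Sn0] := sup_adherent e0 hS.
  exists n0 => n k n0n nk; apply: (le_lt_trans (inc_le _ _ nk)).
  have := inc_le _ _ n0n; have := real_norm_ge0 (u n - u n0); have := leS k.
  by rewrite /S; lra.
have cv : cvg (u n @[n --> \oo]).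
  apply: cauchy_cvg; apply: cauchy_exP => e e0.
  have eE : e = (complex.Re e)%:C%C by rewrite RRe_real // gtr0_real.
  have [n0 hn0] := close (complex.Re e) ltac:(by rewrite -ltcR -eE).
  exists (u n0); exists n0 => // n /= n0n.
  by rewrite -ball_normE /= eE real_normE ltcR real_distrC hn0.
have lim_close e : 0 < e ->
    exists n0, forall n, (n0 <= n)%N -> N (u n - lim (u n @[n --> \oo])) <= e.
  move=> e0; have e0' : 0 < e%:C%C by rewrite ltcE /= eqxx.
  have [n0 _ hn0] := (cvgrPdist_le (u : nat -> V) _).1 cv _ e0'.
  by exists n0 => n /hn0; rewrite /= real_norm_leC real_distrC.
exists (lim (u n @[n --> \oo])) => //.
apply/ler_addgt0Pr => e e0; have [n0 hn0] := lim_close e e0.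
have := hn0 n0 (leqnn _); have := inc_le 0%N n0 (leq0n _).
rewrite u0 eta0 !subr0 => h1 h2; have := hL n0.
have := ler_real_normD (u n0) (lim (u n @[n --> \oo]) - u n0).
by rewrite subrKC (real_distrC (lim _)); lra.
Qed.

End Limits.

(** * Star algebra identities and a square root of [1 - x] *)

Section CStarAlgebra.
Variables (R : realType) (A : cstarAlgType R).
Implicit Types (x y g : A) (t : R) (l : R[i]).
Local Open Scope complex_scope.
Local Notation N := real_norm.
Local Notation one := (1 : A).

Lemma scalemAl l x y : (l *: x) * y = l *: (x * y).
Proof. by rewrite [RHS]cstar_scaleAl. Qed.

Lemma scalemAr l x y : x * (l *: y) = l *: (x * y).
Proof. by rewrite [RHS]cstar_scaleAr. Qed.

Lemma scale2C (V : lmodType R[i]) (x : V) : 2%:C *: x = x + x.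
Proof. by rewrite (rmorphD _ 1 1) scalerDl rmorph1 scale1r. Qed.

Lemma starM x y : star (x * y) = star y * star x.
Proof. exact: cstar_starM. Qed.

Lemma star0 : star (0 : A) = 0.
Proof. by apply: (addrI (star 0)); rewrite -starD !addr0. Qed.

Lemma starN x : star (- x) = - star x.
Proof. by apply/eqP; rewrite -subr_eq0 opprK -starD addNr star0. Qed.

Lemma starB x y : star (x - y) = star x - star y.
Proof. by rewrite starD starN. Qed.

Lemma star1 : star one = 1.
Proof. by rewrite -[LHS]mul1r -{1}(starK 1) -starM mul1r starK. Qed.

Lemma starZr t x : star (t%:C *: x) = t%:C *: star x.
Proof. by rewrite starZ conj_Creal //; apply/complex_realP; exists t. Qed.

Lemma star_real t : star (t%:C *: one) = t%:C *: one.
Proof. by rewrite starZr star1. Qed.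

Lemma ler_real_normM x y : N (x * y) <= N x * N y.
Proof. by rewrite -lecR rmorphM /= -!real_normE cstar_normM. Qed.

Lemma real_norm_starM x : N (star x * x) = N x ^+ 2.
Proof. by apply: complexI; rewrite rmorphXn /= -!real_normE cstar_norm_starM. Qed.

Lemma real_norm_sq x : star x = x -> N (x * x) = N x ^+ 2.
Proof. by move=> xs; rewrite -real_norm_starM xs. Qed.

(** [|x|^2 = |x^* x| <= |x^*| |x|] gives one inequality, and the involution gives the other. *)
Lemma real_norm_star x : N (star x) = N x.
Proof.
suff le_star y : N y <= N (star y).
  by apply/eqP; rewrite eq_le -{2}(starK x) !le_star.
have := real_norm_starM y; have := ler_real_normM (star y) y.
have := real_norm_ge0 y; have := real_norm_ge0 (star y).
rewrite le_eqVlt => /orP[/eqP <-|h1]; rewrite le_eqVlt => /orP[/eqP <-|h2] //; nra.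
Qed.

(* Not an equality, since [1 = 0] is allowed. *)
Lemma real_norm1_le : N one <= 1.
Proof.
by have := real_norm_starM 1; rewrite star1 mul1r; have := real_norm_ge0 one; nra.
Qed.

Lemma real_norm_real_le t : N (t%:C *: one) <= `|t|.
Proof. by rewrite real_normZr ler_piMr ?real_norm1_le. Qed.

Lemma sq_eq0 x : star x = x -> x * x = 0 -> x = 0.
Proof.
move=> xs x0; apply: real_norm_eq0; apply/eqP.
by rewrite -sqrf_eq0 -real_norm_starM xs x0 real_norm0.
Qed.

Lemma star_mul_eq0 x : star x * x = 0 -> x = 0.
Proof.
move=> x0; apply: real_norm_eq0; apply/eqP.
by rewrite -sqrf_eq0 -real_norm_starM x0 real_norm0.
Qed.

Lemma comm_real g t : GRing.comm g (t%:C *: one).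
Proof. by rewrite /GRing.comm scalemAl scalemAr mul1r mulr1. Qed.

Lemma commZ g x l : GRing.comm g x -> GRing.comm g (l *: x).
Proof. by rewrite /GRing.comm scalemAl scalemAr => ->. Qed.

Lemma comm_limit g (u : nat -> A) (x : A) :
  (forall e : R, 0 < e -> exists n0, forall n, (n0 <= n)%N -> N (u n - x) <= e) ->
  (forall n, GRing.comm g (u n)) -> GRing.comm g x.
Proof.
move=> cv gu; apply/eqP; rewrite -subr_eq0; apply/eqP.
apply: (@real_norm_small0 _ _ (2 * N g)) => e /cv[n /(_ n (leqnn n)) un].
have -> : g * x - x * g = (u n - x) * g - g * (u n - x).
  by rewrite mulrBl mulrBr (gu n) opprB [RHS]addrC subrKA.
have := ler_real_normB ((u n - x) * g) (g * (u n - x)).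
have := ler_real_normM (u n - x) g; have := ler_real_normM g (u n - x).
by have := real_norm_ge0 g; nra.
Qed.

Lemma star_limit (u : nat -> A) x :
  (forall e : R, 0 < e -> exists n0, forall n, (n0 <= n)%N -> N (u n - x) <= e) ->
  (forall n, star (u n) = u n) -> star x = x.
Proof.
move=> cv us; apply/eqP; rewrite -subr_eq0; apply/eqP.
apply: (@real_norm_small0 _ _ 2) => e /cv[n /(_ n (leqnn n)) un].
have -> : star x - x = (u n - x) - star (u n - x).
  by rewrite starB us opprB [RHS]addrC subrKA.
have := ler_real_normB (u n - x) (star (u n - x)).
by rewrite real_norm_star; lra.
Qed.

(* [y] is the limit of [u' = (x + u^2) / 2], whose increments are dominated by
   those of the scalar iteration for [x = 1], which is increasing and bounded
   by 1. *)
Lemma sqrt_one_sub x : N x <= 1 -> exists y, [/\ N y <= 1,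
  (1 - y) * (1 - y) = 1 - x, star x = x -> star y = y &
  forall g, GRing.comm g x -> GRing.comm g y].
Proof.
move=> x1.
pose u n := iter n (fun v : A => 2^-1%:C *: (x + v * v)) 0.
pose eta n := iter n (fun v : R => 2^-1 * (1 + v ^+ 2)) 0.
have uS n : u n.+1 = 2^-1%:C *: (x + u n * u n) by [].
have etaS n : eta n.+1 = 2^-1 * (1 + eta n ^+ 2) by [].
have u0 : u 0%N = 0 by []. have eta0 : eta 0%N = 0 by [].
clearbody u eta.
have comm_u g : GRing.comm g x -> forall n, GRing.comm g (u n).
  move=> gx; elim=> [|n IH]; first by rewrite u0; apply: commr0.
  by rewrite uS; apply/commZ/commrD => //; apply: commrM.
(* The iterates commute with everything that commutes with [x], hence with each other, so that
   differences of squares factor below. *)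
have comm_uu m n : GRing.comm (u m) (u n).
  by apply/comm_u/commr_sym/comm_u.
have eta01 n : 0 <= eta n <= 1.
  elim: n => [|n]; first by rewrite eta0 lexx ler01.
  by rewrite etaS; nra.
have norm_u n : N (u n) <= eta n.
  elim: n => [|n IH]; first by rewrite u0 real_norm0 eta0.
  rewrite uS etaS real_normZr ger0_norm ?invr_ge0 // ler_wpM2l ?invr_ge0 //.
  have := ler_real_normD x (u n * u n); have := ler_real_normM (u n) (u n).
  by have := real_norm_ge0 (u n); have := eta01 n; nra.
have inc n : N (u n.+1 - u n) <= eta n.+1 - eta n.
  elim: n => [|n IH].
    rewrite uS etaS u0 eta0 mulr0 addr0 !subr0 real_normZr ger0_norm ?invr_ge0 //.
    by rewrite expr0n addr0 ler_wpM2l ?invr_ge0.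
  rewrite (uS n.+1) {3}(uS n) -scalerBr (addrC x) addrKA.
  have -> : u n.+1 * u n.+1 - u n * u n = (u n.+1 - u n) * (u n.+1 + u n).
    by rewrite mulrBl !mulrDr (comm_uu n.+1 n) opprD addrA addrK.
  rewrite real_normZr ger0_norm ?invr_ge0 //.
  have := ler_real_normM (u n.+1 - u n) (u n.+1 + u n).
  have := ler_real_normD (u n.+1) (u n).
  have := norm_u n; have := norm_u n.+1.
  have := real_norm_ge0 (u n.+1 - u n); have := real_norm_ge0 (u n.+1 + u n).
  have pE := etaS n; rewrite (etaS n.+1).
  set a := N (u n.+1 - u n) in IH *; set b := N (u n.+1 + u n).
  set p := eta n.+1 in IH pE *; set q := eta n in IH pE *.
  move=> b0 a0 pu qu bu ab.
  (* The next scalar increment is [(p - q) (p + q) / 2]. *)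
  suff : a * b <= (p - q) * (p + q) by nra.
  by apply: ler_pM => //; apply: (le_trans bu); apply: lerD.
have [y y1 cv] := dominated_increments_cvg u0 eta0 inc
  (fun n => proj2 (andP (eta01 n))).
exists y; split => //.
(* The fixed point equation [y = (x + y^2) / 2] rearranges to [(1 - y)^2 = 1 - x]. *)
- have yE : y = 2^-1%:C *: (x + y * y).
    apply/eqP; rewrite -subr_eq0; apply/eqP.
    apply: (@real_norm_small0 _ _ 2) => e /cv[n hn].
    have := hn _ (leqnn n); have := hn _ (leqnSn n); rewrite uS => h1 h2.
    have := ler_real_normB (2^-1%:C *: (x + u n * u n) - 2^-1%:C *: (x + y * y)) 
      (2^-1%:C *: (x + u n * u n) - y).
    rewrite opprB addrC subrKA -scalerBr opprD addrACA subrr add0r real_normZr ger0_norm ?invr_ge0 //.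
    have -> : u n * u n - y * y = u n * (u n - y) + (u n - y) * y.
      by rewrite mulrBr mulrBl subrKA.
    have := ler_real_normD (u n * (u n - y)) ((u n - y) * y).
    have := ler_real_normM (u n) (u n - y); have := ler_real_normM (u n - y) y.
    have := norm_u n; have := eta01 n; have := real_norm_ge0 (u n); have := real_norm_ge0 y.
    have := real_norm_ge0 (u n - y).
    set a := N (u n) ; set b := N y in y1 *; set d := N (u n - y) in h2 *.
    move=> d0 b0 a0 /andP[_ eta1] a_eta bd ad D.
    have : a * d <= e by nra.
    have : d * b <= e by nra.
    lra.
  have y2 : y + y = x + y * y by rewrite -scale2C {1}yE scalerA -rmorphM /= mulfV ?scale1r.
  rewrite mulrBl mul1r mulrBr mulr1 -(addrK (y * y) x) -y2.
  by rewrite !opprD !opprK !addrA.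
- by move=> xs; apply: (star_limit cv) => n; elim: n => [|n IH];
  rewrite ?u0 ?star0 // uS starZr starD starM xs IH.
- by move=> g gx; apply: (comm_limit cv) => n; apply: comm_u.
Qed.

End CStarAlgebra.

(** * The cone [psd]: square roots, products and norm bounds *)

Section Psd.
Variables (R : realType) (A : cstarAlgType R).
Implicit Types (a b c p q s x y g : A) (r t : R) (l : R[i]).
Local Open Scope complex_scope.
Local Notation N := real_norm.
Local Notation one := (1 : A).

(* Spectrum-free positivity: for self-adjoint [b], [|t - b| <= t] says that the
   spectrum of [b] lies in [[0, 2 t]]. *)
Definition psd b := star b = b /\ exists2 t : R, 0 < t & N (t%:C *: one - b) <= t.

Lemma psd_star b : psd b -> star b = b. Proof. by case. Qed.

Lemma psd1 : psd 1.
Proof. by split; [exact: star1|exists 1 => //; rewrite rmorph1 scale1r subrr real_norm0]. Qed.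

Lemma psdD b c : psd b -> psd c -> psd (b + c).
Proof.
move=> [bs [t t0 tb]] [cs [t' t'0 tc]]; split; first by rewrite starD bs cs.
exists (t + t'); first exact: addr_gt0.
rewrite rmorphD scalerDl opprD addrACA.
exact: (le_trans (ler_real_normD _ _) (lerD tb tc)).
Qed.

Lemma psdZ r b : 0 <= r -> psd b -> psd (r%:C *: b).
Proof.
rewrite le_eqVlt => /orP[/eqP <- _|r0 [bs [t t0 tb]]].
  rewrite rmorph0 scale0r; split; first exact: star0.
  by exists 1 => //; rewrite subr0 (le_trans (real_norm_real_le _ _)) ?normr1.
split; first by rewrite starZr bs.
exists (r * t); first exact: mulr_gt0.
by rewrite rmorphM -scalerA -scalerBr real_normZr gtr0_norm // ler_pM2l.
Qed.

Lemma psd_real r : 0 <= r -> psd (r%:C *: one).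
Proof. by move=> r0; apply: psdZ => //; apply: psd1. Qed.

Lemma psd_norm_sub b t : star b = b -> N b <= t -> psd (t%:C *: one - b).
Proof.
move=> bs bt; split; first by rewrite starB star_real bs.
have t0 : 0 <= t by apply: le_trans bt; apply: real_norm_ge0.
(* The summand 1 keeps the witness positive when [t = 0]. *)
exists (t + 1); first by rewrite ltr_wpDl.
have -> : (t + 1)%:C *: one - (t%:C *: one - b) = 1 + b.
  by rewrite rmorphD rmorph1 scalerDl scale1r opprB [LHS]addrC addrA subrK addrC.
by have := ler_real_normD one b; have := real_norm1_le A; lra.
Qed.

(** Rescaling by [t] writes [b / t = 1 - x] with [|x| <= 1]. The commutation clause stands in for
    functional calculus. *)
Lemma psd_sqrt b : psd b -> exists s,
  [/\ psd s, s * s = b & forall g, GRing.comm g b -> GRing.comm g s].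
Proof.
move=> [bs [t t0 tb]].
have t1 : 0 <= t^-1 by rewrite invr_ge0 ltW.
pose x : A := 1 - (t^-1)%:C *: b.
have xE : x = (t^-1)%:C *: (t%:C *: one - b).
  by rewrite scalerBr scalerA -rmorphM mulVf ?gt_eqF // rmorph1 scale1r.
have x1 : N x <= 1.
  by rewrite xE real_normZr ger0_norm // mulrC ler_pdivrMr // mul1r.
have [y [y1 ysq ystar ycomm]] := sqrt_one_sub x1.
have st0 : 0 < Num.sqrt t by rewrite sqrtr_gt0.
exists ((Num.sqrt t)%:C *: (1 - y)); split.
- split.
    by rewrite starZr starB star1 ystar // /x starB star1 starZr bs.
  exists (Num.sqrt t) => //.
  by rewrite -scalerBr subKr real_normZr gtr0_norm // ler_piMr // ltW.
- rewrite scalemAl scalemAr scalerA ysq -rmorphM -expr2 sqr_sqrtr ?ltW //.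
  by rewrite /x subKr scalerA -rmorphM mulfV ?gt_eqF // rmorph1 scale1r.
- move=> g gb; apply/commZ/commrB; first exact: commr1.
  by apply: ycomm; apply: commrB; [exact: commr1|exact: commZ].
Qed.

(* [c + i d] is a multiple of a unitary, and [c] is its real part. *)
Lemma normal_real_part_bound c d r : star c = c -> star d = d -> GRing.comm c d ->
  c * c + d * d = r%:C *: one -> 0 <= r -> N c ^+ 2 <= r.
Proof.
move=> cs ds cd sum r0; pose u := c + 'i *: d.
have us : star u = c - 'i *: d.
  by rewrite /u starD starZ cs ds conjCi scaleNr.
have uu : star u * u = r%:C *: one.
  rewrite -sum us /u mulrDr !mulrBl !(scalemAl, scalemAr) scalerA cd.
  by rewrite -(expr2 ('i%R : R[i])) sqrCi scaleN1r opprK addrA subrK.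
have : N u ^+ 2 <= r.
  rewrite -real_norm_starM uu; apply: le_trans (real_norm_real_le _ _) _.
  by rewrite ger0_norm.
have : 2 * N c <= 2 * N u.
  have -> : 2 * N c = N (u + star u).
    rewrite us /u addrACA subrr addr0 -scale2C real_normZr ger0_norm //.
  by have := ler_real_normD u (star u); rewrite real_norm_star; lra.
by have := real_norm_ge0 c; nra.
Qed.

(** If [c] is the root of [t - s^2], then [c^2 + s^2 = t], and the preceding bound gives
    [|t - s^2| = |c|^2 <= t]. *)
Lemma psd_sq s : star s = s -> psd (s * s).
Proof.
move=> ss; split; first by rewrite starM ss.
pose t := N s ^+ 2 + 1.
have t0 : 0 < t by rewrite ltr_wpDl ?exprn_ge0 ?real_norm_ge0.
exists t => //.
have psd_b : psd (t%:C *: one - s * s).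
  by apply: psd_norm_sub; [rewrite starM ss|rewrite real_norm_sq // /t; lra].
have [c [[cs _] cc comm_c]] := psd_sqrt psd_b.
rewrite -cc real_norm_sq //.
have sc : GRing.comm s c.
  by apply: comm_c; apply: commrB; [exact: comm_real|apply: commrM; exact: commr_refl].
apply: (normal_real_part_bound cs ss (commr_sym sc) _ (ltW t0)).
by rewrite cc subrK.
Qed.

(** The roots of [p] and [q] commute, so [p q] is the square of their product, which is
    self-adjoint. *)
Lemma psd_commM p q : psd p -> psd q -> GRing.comm p q -> psd (p * q).
Proof.
move=> pp pq comm_pq.
have [sp [[sps _] spE comm_sp]] := psd_sqrt pp.
have [sq [[sqs _] sqE comm_sq]] := psd_sqrt pq.
have spq : GRing.comm sp sq.
  by apply: comm_sq; apply: commr_sym; apply: comm_sp; apply: commr_sym.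
have -> : p * q = (sp * sq) * (sp * sq).
  by rewrite -spE -sqE -!mulrA; congr (_ * _); rewrite mulrA spq -mulrA -spq.
by apply: psd_sq; rewrite starM sps sqs.
Qed.

(** The commuting roots of [p] and [r - p] have squares with sum [r]. *)
Lemma psd_le_norm p r : 0 <= r -> psd p -> psd (r%:C *: one - p) -> N p <= r.
Proof.
move=> r0 pp pr.
have [s [[ss _] sE comm_s]] := psd_sqrt pp.
have [c [[cs _] cE comm_c]] := psd_sqrt pr.
rewrite -sE real_norm_sq //.
have sc : GRing.comm s c.
  apply: comm_c; apply/commr_sym/comm_s/commr_sym.
  by apply: commrB; [exact: comm_real|exact: commr_refl].
by apply: (normal_real_part_bound ss cs sc _ r0); rewrite sE cE addrC subrK.
Qed.

Lemma psdN_eq0 p : psd p -> psd (- p) -> p = 0.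
Proof.
move=> pp pN; apply: real_norm_eq0; apply/eqP; rewrite eq_le real_norm_ge0 andbT.
by apply: psd_le_norm => //; rewrite rmorph0 scale0r add0r.
Qed.

(** Any positive bound of the norm can thus serve as the [t] in the definition of [psd]. *)
Lemma psd_dist p t : psd p -> N p <= t -> N (t%:C *: one - p) <= t.
Proof.
move=> pp pt; apply: psd_le_norm.
- by apply: le_trans pt; apply: real_norm_ge0.
- exact: psd_norm_sub (psd_star pp) pt.
- by rewrite subKr.
Qed.

(** * Neumann series and inverses *)

Lemma Neumann x r : 0 <= r < 1 -> N x <= r -> exists v,
  [/\ (1 - x) * v = 1, v * (1 - x) = 1 & N v <= (1 - r)^-1].
Proof.
move=> /andP[r0 r1] xr.
(* Partial sums of the geometric series of [x], dominated by those of [r]. *)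
pose u n := iter n (fun v : A => 1 + x * v) 0.
pose eta n := iter n (fun v : R => 1 + r * v) 0.
have uS n : u n.+1 = 1 + x * u n by [].
have etaS n : eta n.+1 = 1 + r * eta n by [].
have u0 : u 0%N = 0 by []. have eta0 : eta 0%N = 0 by [].
clearbody u eta.
have comm_u n : GRing.comm x (u n).
  elim: n => [|n IH]; first by rewrite u0; apply: commr0.
  by rewrite uS; apply: commrD; [exact: commr1|apply: commrM].
have L0 : 0 < (1 - r)^-1 by rewrite invr_gt0 subr_gt0.
have L1 : (1 - r) * (1 - r)^-1 = 1 by rewrite mulfV // subr_eq0 gt_eqF.
have etaL n : eta n <= (1 - r)^-1.
  elim: n => [|n IH]; first by rewrite eta0 ltW.
  by rewrite etaS; set L := _^-1 in IH L0 L1 *; nra.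
have inc n : N (u n.+1 - u n) <= eta n.+1 - eta n.
  elim: n => [|n IH].
    by rewrite uS etaS u0 eta0 !mulr0 !addr0 !subr0 real_norm1_le.
  rewrite (uS n.+1) {2}(uS n) opprD addrACA subrr add0r -mulrBr.
  apply: (le_trans (ler_real_normM _ _)).
  have -> : eta n.+2 - eta n.+1 = r * (eta n.+1 - eta n).
    by rewrite (etaS n.+1); have := etaS n; lra.
  by apply: ler_pM => //; apply: real_norm_ge0.
have [v v1 cv] := dominated_increments_cvg u0 eta0 inc etaL.
have vE : 1 + x * v = v.
  apply/eqP; rewrite -subr_eq0; apply/eqP.
  apply: (@real_norm_small0 _ _ 2) => e e0; have [n hn] := cv e e0.
  have := hn _ (leqnn n); have := hn _ (leqnSn n); rewrite uS => h1 h2.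
  have := ler_real_normB (1 + x * u n - v) (x * (u n - v)).
  have <- : 1 + x * v - v = (1 + x * u n - v) - x * (u n - v).
    rewrite mulrBr opprB -!addrA; congr (_ + _).
    by rewrite [RHS]addrC -addrA subrK addrC.
  have := ler_real_normM x (u n - v).
  by have := real_norm_ge0 (u n - v); have := real_norm_ge0 x; nra.
have xv : GRing.comm x v by apply: (comm_limit cv).
exists v; split => //.
  by apply/eqP; rewrite mulrBl mul1r subr_eq vE.
by apply/eqP; rewrite mulrBr mulr1 -xv subr_eq vE.
Qed.

(** [r + q = (r + t) (1 - x)] with [x = (t - q) / (r + t)], of norm at most [t / (r + t) < 1]; the
    Neumann bound then becomes [1 / r]. *)
Lemma psd_inv q r : 0 < r -> psd q -> exists w,
  [/\ w * (r%:C *: one + q) = 1, (r%:C *: one + q) * w = 1, star w = w & N w <= r^-1].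
Proof.
move=> r0 [qs [t t0 tq]].
have rt0 : 0 < r + t by rewrite addr_gt0.
have rtN : r + t != 0 by rewrite gt_eqF.
pose x := ((r + t)^-1)%:C *: (t%:C *: one - q).
have rqE : r%:C *: one + q = (r + t)%:C *: (1 - x).
  rewrite scalerBr scalerA -rmorphM mulfV // rmorph1 scale1r opprB rmorphD scalerDl.
  by rewrite -addrA subrKC.
have xr : N x <= t / (r + t).
  by rewrite real_normZr ger0_norm ?invr_ge0 ?(ltW rt0) // mulrC ler_pM2r ?invr_gt0.
have r01 : 0 <= t / (r + t) < 1.
  by rewrite divr_ge0 ?(ltW t0) ?(ltW rt0) // ltr_pdivrMr // mul1r; lra.
have [v [v1 v2 vN]] := Neumann r01 xr.
pose w := ((r + t)^-1)%:C *: v.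
have w1 : w * (r%:C *: one + q) = 1.
  by rewrite rqE /w scalemAl scalemAr scalerA -rmorphM mulVf // rmorph1 scale1r.
have w2 : (r%:C *: one + q) * w = 1.
  by rewrite rqE /w scalemAl scalemAr scalerA -rmorphM mulfV // rmorph1 scale1r.
exists w; split => //.
  have sw : star w * (r%:C *: one + q) = 1.
    by rewrite -[LHS]starK starM starK starD star_real qs w2 star1.
  by rewrite -[LHS]mulr1 -w2 mulrA sw mul1r.
rewrite /w real_normZr ger0_norm ?invr_ge0 ?(ltW rt0) // mulrC ler_pdivrMr //.
apply: (le_trans vN); rewrite le_eqVlt; apply/orP; left; apply/eqP.
by field; rewrite ?rtN ?gt_eqF.
Qed.

End Psd.

(** * Positivity of [x^* x] *)

Section Modulus.
Variables (R : realType) (A : cstarAlgType R).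
Implicit Types (a b c p q s x y z g : A) (r t : R) (l : R[i]).
Local Open Scope complex_scope.
Local Notation N := real_norm.
Local Notation one := (1 : A).

(** Up to a factor 1/2 this is [u^2 + v^2], where [u] and [v] are twice the real and imaginary parts
    of [z]. It makes [z z^*] positive when [z^* z] is negative. *)
Lemma psd_cartesian z : psd (z * star z + star z * z).
Proof.
pose u := z + star z; pose v := 'i *: (star z - z).
have us : star u = u by rewrite starD starK addrC.
have vs : star v = v by rewrite starZ conjCi starB starK scaleNr -scalerN opprB.
have -> : z * star z + star z * z = (2^-1)%:C *: (u * u + v * v).
  rewrite scalemAl scalemAr scalerA -(expr2 ('i%R : R[i])) sqrCi scaleN1r.
  have half (w : A) : w = (2^-1)%:C *: (w + w).
    by rewrite -scale2C scalerA -rmorphM mulVf // rmorph1 scale1r.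
  rewrite [LHS]half; congr (_ *: _).
  set s := star z.
  have -> : u * u = (z * z + s * s) + (z * s + s * z).
    by rewrite /u -/s mulrDr !mulrDl addrACA [s * z + _]addrC addrACA.
  have -> : (s - z) * (s - z) = (z * z + s * s) - (z * s + s * z).
    by rewrite mulrBr !mulrBl opprB addrACA -opprD [s * s + _]addrC.
  by rewrite opprB [RHS]addrC subrKA.
by apply: psdZ; [rewrite invr_ge0|apply: psdD; apply: psd_sq].
Qed.

(* Writing [p] for [- z^* z] and [n] for [|z|^2], the element
   [k = - z^* (n + z z^* )^-1 z] of norm at most 1 satisfies [(n - p) k = p], so
   that [n - 2 p = (n - p) (1 - k)] is positive, whence [2 |p| <= n = |p|]. *)
Lemma psdN_star_mul_eq0 z : psd (- (star z * z)) -> z = 0.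
Proof.
set p := - _ => pp; pose n := N z ^+ 2.
have pN : N p = n by rewrite real_normN real_norm_starM.
have qp : psd (z * star z).
  by have := psdD (psd_cartesian z) pp; rewrite addrK.
have : 0 <= n by rewrite exprn_ge0 ?real_norm_ge0.
rewrite le_eqVlt => /orP[/eqP n0|n0].
  by apply: real_norm_eq0; apply/eqP; rewrite -sqrf_eq0 -/n -n0.
have [w [w1 w2 ws wN]] := psd_inv n0 qp.
pose k := - (star z * w * z).
have ks : star k = k by rewrite starN !starM starK ws mulrA.
have kp : k * (n%:C *: one - p) = p.
  have -> : k * (n%:C *: one - p) = - (star z * (w * (n%:C *: one + z * star z)) * z).
    rewrite /k mulNr -!mulrA; congr (- (_ * (_ * _))).
    by rewrite mulrBr mulrDl scalemAl scalemAr mulr1 mul1r /p mulrN opprK mulrA.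
  by rewrite w1 mulr1.
have pk : (n%:C *: one - p) * k = p.
  by have := congr1 star kp; rewrite starM ks starB star_real (psd_star pp).
have kN : N k <= 1.
  rewrite real_normN; apply: (le_trans (ler_real_normM _ _)).
  apply: (@le_trans _ _ (N z * n^-1 * N z)).
    apply: ler_wpM2r; first exact: real_norm_ge0.
    apply: (le_trans (ler_real_normM _ _)); rewrite real_norm_star.
    by apply: ler_wpM2l => //; apply: real_norm_ge0.
  by rewrite mulrAC -expr2 mulfV // gt_eqF.
have : psd ((n%:C *: one - p) * (1 - k)).
  apply: psd_commM.
  - by apply: psd_norm_sub; rewrite ?psd_star ?pN.
  - by have := psd_norm_sub ks kN; rewrite rmorph1 scale1r.
  - by apply: commrB; [exact: commr1|rewrite /GRing.comm pk kp].
rewrite mulrBr mulr1 pk -addrA -opprD => psd2.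
have := psd_le_norm (ltW n0) (psdD pp pp) psd2.
rewrite -scale2C real_normZr ger0_norm // pN => n2.
by exfalso; lra.
Qed.

(* With [y = x^* x] and [m] the square root of [y^2], the element [k = m - y] is
   twice the negative part of [y], and [(x k)^* (x k) = - k m k]. *)
Lemma psd_star_mul x : psd (star x * x).
Proof.
set y := _ * x.
have ys : star y = y by rewrite starM starK.
have [m [pm mm comm_m]] := psd_sqrt (psd_sq ys).
have ym : GRing.comm y m by apply: comm_m; apply: commrM; apply: commr_refl.
pose k := m - y.
have ks : star k = k by rewrite starB ys psd_star.
have km : GRing.comm k m.
  by apply/commr_sym/commrB; [exact: commr_refl|exact/commr_sym].
(* This is [(m - y) (m + y) = m^2 - y^2 = 0]. *)
have k_my : k * y = - (k * m).
  by apply/eqP; rewrite -subr_eq0 opprK -mulrDr /k mulrBl !mulrDr mm ym addrKA subrr.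
have psd_kmk : psd (k * m * k).
  rewrite -mulrA -km mulrA; apply: psd_commM => //; first exact: psd_sq.
  by apply/commr_sym/commrM; apply/commr_sym.
have xk0 : x * k = 0.
  apply: psdN_star_mul_eq0.
  by rewrite starM ks mulrA -(mulrA k) -/y k_my mulNr opprK.
have kyk0 : k * y * k = 0 by rewrite /y mulrA -mulrA xk0 mulr0.
have kmk0 : k * m * k = 0.
  by move: kyk0; rewrite k_my mulNr => /eqP; rewrite oppr_eq0 => /eqP.
have k3 : k * k * k = 0.
  have <- : k * m * k - k * y * k = k * k * k by rewrite -mulrBl -mulrBr.
  by rewrite kmk0 kyk0 subr0.
(* [k^3 = 0] gives [(k^2)^2 = 0]; as [k] and [k^2] are self-adjoint, both vanish. *)
have k0 : k = 0.
  apply: sq_eq0 => //; apply: sq_eq0; first by rewrite starM ks.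
  by rewrite mulrA k3 mul0r.
by move/eqP: k0; rewrite subr_eq0 => /eqP <-.
Qed.

(** With [s] the root of [p], the element is [(s x)^* (s x)]. *)
Lemma psd_conj x p : psd p -> psd (star x * p * x).
Proof.
move=> pp; have [s [[ss _] <- _]] := psd_sqrt pp.
have -> : star x * (s * s) * x = star (s * x) * (s * x) by rewrite starM ss !mulrA.
exact: psd_star_mul.
Qed.

(** * The cone compared with spectral positivity *)

Lemma invertible_lr x y z : x * y = 1 -> z * x = 1 -> invertible x.
Proof.
move=> xy zx; exists y; split => //.
by rewrite -[y]mul1r -zx -(mulrA z) xy mulr1.
Qed.

(** For real [l < 0], [s - l] is inverted by [psd_inv]. For [l = al + i be] with [be != 0], put
    [h = s - al]: then [(h - i be) (h + i be) = h^2 + be^2] is invertible. *)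
Lemma psd_positive s : psd s -> positive s.
Proof.
move=> ps; have ss := psd_star ps; split => // -[al be] sp.
apply: contrapT => l0; apply: sp.
have lE : al +i* be = al%:C + 'i * be%:C by rewrite [LHS]complexE.
have [be0|be0] := eqVneq be 0.
  have al0 : 0 < - al.
    by rewrite oppr_gt0 ltNge; apply/negP => al0; apply: l0; rewrite /= lecE /= be0 eqxx.
  have [w [w1 w2 _ _]] := psd_inv al0 ps.
  exists w; rewrite lE be0 rmorph0 mulr0 addr0.
  have -> : s - al%:C *: one = (- al)%:C *: one + s by rewrite rmorphN scaleNr addrC.
  by [].
pose h := s - al%:C *: one.
have hs : star h = h by rewrite starB ss star_real.
have -> : s - (al +i* be) *: one = h - ('i * be%:C) *: one.
  by rewrite lE scalerDl opprD addrA.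
clearbody h.
have be2 : 0 < be ^+ 2 by rewrite exprn_even_gt0.
have [w [w1 w2 _ _]] := psd_inv be2 (psd_sq hs).
pose y := h + ('i * be%:C) *: one.
have i2 : ('i * be%:C) * ('i * be%:C) = - (be ^+ 2)%:C :> R[i].
  by rewrite mulrACA -(expr2 'i%C) sqr_i mulN1r -rmorphM.
have xy : (h - ('i * be%:C) *: one) * y = (be ^+ 2)%:C *: one + h * h.
  rewrite /y mulrDr !mulrBl !(scalemAl, scalemAr) !mul1r !mulr1 scalerA i2 scaleNr.
  by rewrite opprK addrA subrK addrC.
have yx : y * (h - ('i * be%:C) *: one) = (be ^+ 2)%:C *: one + h * h.
  rewrite /y mulrBr !mulrDl !(scalemAl, scalemAr) !mul1r !mulr1 scalerA i2 scaleNr.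
  by rewrite opprD opprK addrA addrK addrC.
by apply: (@invertible_lr _ (y * w) (w * y)); rewrite -?mulrA ?yx // mulrA xy.
Qed.

(** The inverse [y = y p y] is in the cone, and [p - 1/M = p (M - y) / M] for [M >= |y|]. *)
Lemma psd_invertible_sub p : psd p -> invertible p ->
  exists2 d : R, 0 < d & psd (p - d%:C *: one).
Proof.
move=> pp [y [py yp]].
have ys : star y = y.
  have sy : star y * p = 1 by rewrite -[p]psd_star // -starM py star1.
  by rewrite -[LHS]mulr1 -py mulrA sy mul1r.
have py_psd : psd y.
  by have := psd_conj y pp; rewrite ys yp mul1r.
pose M := N y + 1.
have M0 : 0 < M by rewrite ltr_wpDl ?real_norm_ge0.
have yM : N y <= M by rewrite /M; lra.
exists M^-1; first by rewrite invr_gt0.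
have -> : p - M^-1%:C *: one = M^-1%:C *: (p * (M%:C *: one - y)).
  rewrite mulrBr scalemAr mulr1 py scalerBr scalerA -rmorphM mulVf ?gt_eqF //.
  by rewrite rmorph1 scale1r.
apply: psdZ; first by rewrite invr_ge0 ltW.
apply: psd_commM => //; first exact: psd_norm_sub.
by apply: commrB; [exact: comm_real|rewrite /GRing.comm py yp].
Qed.

(** The same [t = |b| + 1] works for all [b + d] with [0 < d <= 1], so [d] can tend to 0 in
    [|t - (b + d)| <= t]. *)
Lemma psd_closed b : star b = b ->
  (forall e, 0 < e -> psd (b + e%:C *: one)) -> psd b.
Proof.
move=> bs be; split => //; pose t := N b + 1.
exists t; first by rewrite ltr_wpDl ?real_norm_ge0.
apply/ler_addgt0Pr => e e0.
pose d := Num.min e 1.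
have d0 : 0 < d by rewrite lt_min e0 ltr01.
have [de d1] : d <= e /\ d <= 1 by rewrite /d !ge_min !lexx orbT.
have dN : N (d%:C *: one) <= d.
  by apply: (le_trans (real_norm_real_le _ _)); rewrite gtr0_norm.
have bt : N (b + d%:C *: one) <= t.
  by have := ler_real_normD b (d%:C *: one); rewrite /t; lra.
have := psd_dist (be d d0) bt.
have := ler_real_normD (t%:C *: one - (b + d%:C *: one)) (d%:C *: one).
by rewrite opprD addrA subrK; lra.
Qed.

(* The least [l >= 0] such that [b + l] is positive is 0, since otherwise
   [b + l] would be invertible, and could be decreased. *)
Lemma positive_psd b : positive b -> psd b.
Proof.
move=> [bs sp].
have inv r : 0 < r -> invertible (b + r%:C *: one).
  move=> r0; apply: contrapT => ninv.
  have /sp /= : spectrum b (- r)%:C by rewrite /spectrum /= rmorphN scaleNr opprK.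
  by rewrite lecR oppr_ge0 leNgt r0.
pose E : set R := [set r | 0 <= r /\ psd (b + r%:C *: one)].
have E_N : E (N b).
  split; first exact: real_norm_ge0.
  rewrite addrC -[b in _ + b]opprK; apply: psd_norm_sub; first by rewrite starN bs.
  by rewrite real_normN.
have infE : has_inf E by split; [exists (N b)|exists 0 => r []].
have inf0 : 0 <= inf E by apply: lb_le_inf; [exists (N b)|move=> r []].
(* The infimum is attained because the cone is closed. *)
have psd_inf : psd (b + (inf E)%:C *: one).
  apply: psd_closed; first by rewrite starD bs star_real.
  move=> e e0; have [r [r0 rE] rlt] := inf_adherent e0 infE.
  have -> : b + (inf E)%:C *: one + e%:C *: one =
      (b + r%:C *: one) + (inf E + e - r)%:C *: one.
    rewrite -!addrA -!scalerDl -!rmorphD.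
    by congr (_ + _%:C *: _); lra.
  by apply: psdD => //; apply: psd_real; rewrite subr_ge0 ltW.
move: inf0; rewrite le_eqVlt => /orP[/eqP inf0|inf0].
  by move: psd_inf; rewrite -inf0 rmorph0 scale0r addr0.
have [d d0 pd] := psd_invertible_sub psd_inf (inv _ inf0).
(* Members of [E] are nonnegative, hence the cut-off at 0; [r] is still below [inf E]. *)
pose r := Num.max 0 (inf E - d).
have rE : E r.
  split; first by rewrite le_max lexx.
  have -> : b + r%:C *: one =
      (b + (inf E)%:C *: one - d%:C *: one) + (r - (inf E - d))%:C *: one.
    rewrite -!addrA -!scaleNr -!scalerDl -!rmorphN -!rmorphD.
    by congr (_ + _%:C *: _); lra.
  by apply: psdD => //; apply: psd_real; rewrite subr_ge0 le_max lexx orbT.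
have : inf E <= r by apply: ge_inf => //; exact: infE.2.
by rewrite le_max !leNgt inf0 ltrBlDr ltrDl d0.
Qed.

(** * Moduli and their intertwining relation *)

Lemma modulusP a : psd (modulus a) /\ modulus a * modulus a = star a * a.
Proof.
have [s [ps sE _]] := psd_sqrt (psd_star_mul a).
(* A root in the cone has nonnegative spectrum, so [xget] returns a genuine root and not its default
   0. *)
have : [set b | positive b /\ b ^+ 2 = star a * a] (modulus a).
  by apply: xgetPex; exists s; split; [exact: psd_positive|rewrite expr2].
by case=> /positive_psd ? ; rewrite expr2.
Qed.

Lemma psd_modulus a : psd (modulus a). Proof. exact: (modulusP a).1. Qed.

Lemma modulus_sq a : modulus a * modulus a = star a * a.
Proof. exact: (modulusP a).2. Qed.

(* With [b] and [c] the moduli, [x = a b - c a] satisfies [c x = - x b]; hence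
   [x b x^* = - c (x x^* )] is both positive and negative. *)
Lemma modulus_intertwine a : a * modulus a = modulus (star a) * a.
Proof.
set b := modulus a; set c := modulus _.
have pb : psd b := psd_modulus a. have pc : psd c := psd_modulus (star a).
have [bs cs] := (psd_star pb, psd_star pc).
have bb : b * b = star a * a := modulus_sq a.
have cc : c * c = a * star a by rewrite [LHS]modulus_sq starK.
pose x := a * b - c * a.
have cx : c * x = - (x * b).
  apply/eqP; rewrite -subr_eq0 opprK mulrBr mulrBl -(mulrA a) bb.
  by rewrite (mulrA c c) cc (mulrA c a) (mulrA a (star a)) subrKA subrr.
have xbx : psd (x * b * star x) by rewrite -{1}(starK x); apply: psd_conj.
have cxx : c * (x * star x) = - (x * b * star x) by rewrite mulrA cx mulNr.
have xbx0 : x * b * star x = 0.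
  apply: psdN_eq0 => //; rewrite -cxx; apply: psd_commM => //.
    by rewrite -{1}(starK x); apply: psd_star_mul.
  rewrite /GRing.comm cxx -[RHS]starK starM cs (starM x) starK cxx.
  by rewrite starN (psd_star xbx).
have [s [[ss _] sE _]] := psd_sqrt pb.
have xs0 : s * star x = 0.
  by apply: star_mul_eq0; rewrite starM starK ss mulrA -(mulrA x) sE.
have xb0 : x * b = 0.
  by rewrite -sE mulrA -[x * s]starK starM ss xs0 star0 mul0r.
have cx0 : c * x = 0 by rewrite cx xb0 oppr0.
have xc0 : star x * c = 0 by rewrite -[LHS]starK starM starK cs cx0 star0.
have bx0 : b * star x = 0 by rewrite -[LHS]starK starM starK bs xb0 star0.
have xx : x * star x = - (c * (a * star x)).
  by rewrite {1}/x mulrBl -mulrA bx0 mulr0 sub0r mulrA.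
(* One factor is replaced by [- c a x^*], and [x^* c = 0] makes the square vanish. *)
have xx0 : x * star x = 0.
  apply: sq_eq0; first by rewrite starM starK.
  by rewrite {2}xx mulrN -(mulrA x) (mulrA _ c) xc0 mul0r mulr0 oppr0.
have x0 : star x = 0 by apply: star_mul_eq0; rewrite starK.
by apply/eqP; rewrite -subr_eq0 -[X in X == 0]starK -/x x0 star0.
Qed.

End Modulus.

(** * States: positivity and Schwarz inequalities *)

Section States.
Variables (R : realType) (A : cstarAlgType R).
Local Open Scope complex_scope.
Local Notation N := real_norm.
Local Notation one := (1 : A).

Variable f : {linear A -> R[i]^o}.
Hypothesis fS : states f.
Implicit Types (a b c h p x y : A) (t : R).
Local Notation F x := (complex.Re (f x)).
Local Notation nrm := (@real_norm R R[i]^o).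

Lemma real_norm_sqr (z : R[i]) : nrm z ^+ 2 = complex.Re z ^+ 2 + complex.Im z ^+ 2.
Proof. by apply: complexI; rewrite add_Re2_Im2 rmorphXn /= -real_normE. Qed.

Lemma Re_le_real_norm (z : R[i]) : `|complex.Re z| <= nrm z.
Proof.
rewrite -ler_sqr ?nnegrE ?real_norm_ge0 // real_norm_sqr.
by rewrite real_normK ?num_real // lerDl sqr_ge0.
Qed.

Lemma state_le x : nrm (f x) <= N x.
Proof.
have [_ _ fn] := fS.
have hs : has_sup [set real_norm (f x) | x in [set x : A | `|x| <= 1]].
  (* A set without supremum has [sup] 0, whereas here it is 1. *)
  by apply: contrapT => /sup_out; rewrite -/(dual_norm f) fn => /eqP; rewrite oner_eq0.
have unit_le y : N y <= 1 -> nrm (f y) <= 1.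
  move=> y1; rewrite -[leRHS]fn; apply: (sup_upper_bound hs).
  by exists y => //=; rewrite -(rmorph1 (real_complex R)) real_norm_leC.
have := real_norm_ge0 x; rewrite le_eqVlt => /orP[/eqP x0|x0].
  by rewrite (real_norm_eq0 (esym x0)) linear0 !real_norm0.
have /unit_le : N ((N x)^-1%:C *: x) <= 1.
  by rewrite real_normZr ger0_norm ?invr_ge0 ?real_norm_ge0 // mulVf ?gt_eqF.
rewrite linearZ /= real_normZr ger0_norm ?invr_ge0 ?real_norm_ge0 //.
by rewrite mulrC ler_pdivrMr // mul1r.
Qed.

Lemma state1 : f 1 = 1. Proof. by case: fS. Qed.

Lemma state_scale (l : R[i]) x : f (l *: x) = l * f x.
Proof. by rewrite linearZ. Qed.

Lemma ReZ t x : F (t%:C *: x) = t * F x.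
Proof. by rewrite state_scale; case: (f x) => u v /=; rewrite mul0r subr0. Qed.

(* [|f (h + i t)|^2 <= |h^2 + t^2|] for every real [t] forces [Im f(h) = 0]. *)
Lemma state_Im h : star h = h -> complex.Im (f h) = 0.
Proof.
move=> hs; set be := complex.Im _; set al := F h.
have key t : al ^+ 2 + (be + t) ^+ 2 <= N h ^+ 2 + t ^+ 2.
  pose u := h + ('i * t%:C) *: one.
  have uu : star u * u = h * h + (t ^+ 2)%:C *: one.
    rewrite /u starD starZ star1 hs rmorphM /= conjCi conj_Creal; last first.
      by apply/complex_realP; exists t.
    rewrite mulrDr !mulrDl !(scalemAl, scalemAr) !mulr1 !mul1r scalerA -addrA (addrA (_ *: h)).
    rewrite -scalerDl mulNr addNr scale0r add0r mulNr mulrACA -(expr2 ('i : R[i])).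
    by rewrite sqrCi mulN1r opprK -rmorphM -expr2.
  have fu : f u = al +i* (be + t).
    rewrite /u linearD state_scale state1 mulr1 /al /be.
    by case: (f h) => p q; rewrite -complexiE; simpc.
  have := state_le u; rewrite -ler_sqr ?nnegrE ?real_norm_ge0 //.
  rewrite -[leRHS]real_norm_starM uu fu real_norm_sqr /= => /le_trans; apply.
  apply: (le_trans (ler_real_normD _ _)); rewrite real_norm_sq // lerD2l.
  by apply: (le_trans (real_norm_real_le _ _)); rewrite ger0_norm ?sqr_ge0.
apply/eqP/negPn/negP => be0.
(* This [t] gives [2 be t = |h|^2 + 1], against [al^2 + be^2 + 2 be t <= |h|^2]. *)
have := key ((N h ^+ 2 + 1) / (2 * be)).
set t := _ / _; have tE : 2 * be * t = N h ^+ 2 + 1 by rewrite /t; field.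
by have := sqr_ge0 al; have := sqr_ge0 be; nra.
Qed.

Lemma state_realE h : star h = h -> f h = (F h)%:C.
Proof. by move/state_Im; case: (f h) => u v /= ->. Qed.

(** With [t = |p|], contractivity gives [t - f(p) <= |t - p| <= t]. *)
Lemma state_psd p : psd p -> 0 <= F p.
Proof.
move=> pp; have := state_le ((N p)%:C *: one - p).
move/le_trans => /(_ _ (psd_dist pp (lexx _))).
move/(le_trans (Re_le_real_norm _)); rewrite linearB state_scale state1 mulr1 raddfB /=.
by move/(le_trans (ler_norm _)); lra.
Qed.

(** [f] is real on the self-adjoint elements [x + x^*] and [i (x^* - x)]. *)
Lemma state_star x : f (star x) = (f x)^*%C.
Proof.
have h1 : star (x + star x) = x + star x by rewrite starD starK addrC.
have h2 : star ('i *: (star x - x)) = 'i *: (star x - x).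
  by rewrite starZ conjCi starB starK scaleNr -scalerN opprB.
have := state_Im h1; have := state_Im h2.
rewrite state_scale linearB linearD -complexiE.
case: (f x) => u v; case: (f (star x)) => u' v'; simpc => /= e1 e2.
by apply/eqP; rewrite eq_complex /=; apply/andP; split; apply/eqP; lra.
Qed.

Lemma state_CauchySchwarz x y :
  nrm (f (x * y)) ^+ 2 <= F (x * star x) * F (star y * y).
Proof.
set z := f (x * y); set n := nrm z ^+ 2.
set p := F (x * star x); set q := F (star y * y).
have n0 : 0 <= n by rewrite exprn_ge0 ?real_norm_ge0.
have psd_x : psd (x * star x) by rewrite -{1}(starK x); apply: psd_star_mul.
have p0 : 0 <= p by apply: state_psd.
have q0 : 0 <= q by apply/state_psd/psd_star_mul.
have zz : z * z^*%C = n%:C.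
  by rewrite -sqr_normc rmorphXn /= -(@real_normE _ R[i]^o).
clearbody n.
have key t : 0 <= p - 2 * t * n + t ^+ 2 * n * q.
  pose l := - (t%:C * z); pose v := x + l *: star y.
  have psd_v : psd (v * star v) by rewrite -{1}(starK v); apply: psd_star_mul.
  have -> : p - 2 * t * n + t ^+ 2 * n * q = F (v * star v); last exact: state_psd.
  apply: complexI; rewrite -[RHS](state_realE (psd_star psd_v)).
  have lc : (l^*)%R = - (t%:C * z^*%C).
    rewrite /l rmorphN rmorphM /= conj_Creal //.
    by apply/complex_realP; exists t.
  rewrite /v starD starZ starK mulrDr !mulrDl !(scalemAl, scalemAr) !linearD !state_scale.
  rewrite -/z -starM state_star -/z (state_realE (psd_star psd_x)) -/p.
  rewrite (state_realE (psd_star (psd_star_mul y))) -/q lc.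
  rewrite !(rmorphD, rmorphN, rmorphM, rmorphXn) /= -zz /l rmorph1.
  by ring.
have [q00|qn0] := eqVneq q 0.
  rewrite q00 mulr0 leNgt; apply/negP => nn.
  (* For [q = 0] the quadratic becomes [p - 2 t n], and this [t] gives it the value -1. *)
  have := key ((p + 1) / (2 * n)); rewrite q00.
  set t := _ / _; have tE : 2 * t * n = p + 1 by rewrite /t; field; rewrite gt_eqF.
  by rewrite tE mulr0; lra.
have qgt : 0 < q by rewrite lt_neqAle eq_sym qn0.
have := key q^-1.
have -> : p - 2 * q^-1 * n + q^-1 ^+ 2 * n * q = (p * q - n) / q by field.
by rewrite pmulr_lge0 ?invr_gt0 // subr_ge0.
Qed.

(* With [e^2 = b + eps], write [a = (a (b + eps)^-1 e) e]; as [a b = c a], the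
   first factor [x] satisfies [x x^* = (c + eps)^-1 c^2 <= c]. *)
Lemma state_mixed_Schwarz a :
  nrm (f a) ^+ 2 <= F (modulus a) * F (modulus (star a)).
Proof.
set b := modulus a; set c := modulus _.
have pb : psd b := psd_modulus a. have pc : psd c := psd_modulus (star a).
have ab : a * b = c * a := modulus_intertwine a.
have cc : c * c = a * star a by rewrite [LHS]modulus_sq starK.
have [b0 c0] := (state_psd pb, state_psd pc).
suff key r : 0 < r -> nrm (f a) ^+ 2 <= (F b + r) * F c.
  (* [F c] may vanish, hence the denominator [F c + 1]. *)
  apply/ler_addgt0Pr => e e0; have c1 : 0 < F c + 1 by rewrite ltr_wpDl.
  apply: (le_trans (key (e / (F c + 1)) _)); first by rewrite divr_gt0.
  rewrite mulrDl lerD2l mulrAC ler_pdivrMr // ler_wpM2l ?(ltW e0) //.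
  by rewrite lerDl.
move=> r0.
have [w [w1 w2 ws _]] := psd_inv r0 pb.
have [w' [w'1 w'2 w's _]] := psd_inv r0 pc.
have [e [[es _] eE _]] := psd_sqrt (psdD (psd_real A (ltW r0)) pb).
have aw : a * w = w' * a.
  have ar : a * (r%:C *: one + b) = (r%:C *: one + c) * a.
    by rewrite mulrDr mulrDl ab scalemAl scalemAr mulr1 mul1r.
  by rewrite -[LHS]mul1r -w'1 -mulrA (mulrA _ a) -ar -mulrA w2 mulr1.
(* [w' = w' (r + c) w']. *)
have psd_w' : psd w'.
  by have := psd_conj w' (psdD (psd_real A (ltW r0)) pc); rewrite w's w'1 mul1r.
have w'c : GRing.comm w' c.
  have : GRing.comm w' (r%:C *: one + c) by rewrite /GRing.comm w'1 w'2.
  move/commrB => /(_ _ (comm_real w' r)).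
  by rewrite addrC addKr.
have aE : a = (a * w * e) * e by rewrite -!mulrA eE w1 mulr1.
have xx : (a * w * e) * star (a * w * e) = w' * (c * c).
  rewrite !starM es ws mulrA -(mulrA _ e e) eE -!mulrA (mulrA w (_ + _)) w1 mul1r.
  by rewrite mulrA aw -mulrA cc.
(* The difference [c - w' c^2 = r w' c] is positive. *)
have le_c : F (w' * (c * c)) <= F c.
  have : psd (r%:C *: (w' * c)) by apply: psdZ; [exact: ltW|apply: psd_commM].
  move/state_psd.
  have -> : r%:C *: (w' * c) = c - w' * (c * c).
    apply/esym/eqP; rewrite subr_eq; apply/eqP.
    by rewrite -[LHS]mul1r -w'1 -mulrA mulrDl mulrDr scalemAl mul1r scalemAr.
  by rewrite linearB raddfB subr_ge0.
rewrite {1}aE; apply: (le_trans (state_CauchySchwarz _ _)).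
rewrite xx es eE linearD raddfD /= ReZ state1 mulr1 mulrC addrC.
by apply: ler_wpM2l => //; rewrite addr_ge0 // ltW.
Qed.

(* Buzano's inequality: apply Cauchy-Schwarz to the reflection
   [2 f(b) - b] of [b] and to [c]. *)
Lemma state_modulus_bound a :
  nrm (f a) ^+ 2 <= 4^-1 * nrm (f (modulus a + 'i%C *: modulus (star a))) ^+ 2
    + 4^-1 * nrm (f (modulus a * modulus (star a)))
    + 8^-1 * F (modulus a ^+ 2 + modulus (star a) ^+ 2).
Proof.
have := state_mixed_Schwarz a; set b := modulus a; set c := modulus _.
have bs : star b = b := psd_star (psd_modulus a).
have cs : star c = c := psd_star (psd_modulus (star a)).
set al := F b; set ga := F c => mixed.
have -> : nrm (f (b + 'i%C *: c)) ^+ 2 = al ^+ 2 + ga ^+ 2.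
  rewrite linearD state_scale (state_realE bs) (state_realE cs) real_norm_sqr.
  by rewrite -/al -/ga; simpc.
pose x := (2 * al)%:C *: one - b.
have xs : star x = x by rewrite starB star_real bs.
have xc : f (x * c) = (2 * al * ga)%:C - f (b * c).
  rewrite mulrBl scalemAl mul1r linearB state_scale (state_realE cs).
  by rewrite -/ga [in RHS]rmorphM.
(* Since [f(x) = al], applying [f] to [x^2 = 2 al x - x b] leaves [f(b^2)]. *)
have xx : F (x * star x) = F (b * b).
  have FB u v : F (u - v) = F u - F v by rewrite linearB raddfB.
  have Fx : F x = al by rewrite FB ReZ state1 /= -/al; lra.
  have xb : x * b = (2 * al)%:C *: b - b * b by rewrite mulrBl scalemAl mul1r.
  have -> : x * star x = (2 * al)%:C *: x - x * b.
    by rewrite xs {2}/x mulrBr scalemAr mulr1.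
  by rewrite FB ReZ Fx xb FB ReZ -/al; lra.
have := state_CauchySchwarz x c; rewrite xx cs xc.
have bc_le : 2 * al * ga <= nrm ((2 * al * ga)%:C - f (b * c)) + nrm (f (b * c)).
  apply: le_trans (ler_real_normD _ _); rewrite subrK.
  exact: (le_trans (ler_norm _) (Re_le_real_norm (2 * al * ga)%:C)).
rewrite !expr2 linearD raddfD /=.
have b20 : 0 <= F (b * b) by apply/state_psd/psd_sq.
have c20 : 0 <= F (c * c) by apply/state_psd/psd_sq.
move: bc_le b20 c20; set d := nrm (_ - _); set e := nrm (f (b * c)).
have d0 : 0 <= d by apply: real_norm_ge0.
set be2 := F (b * b); set ga2 := F (c * c) => bc_le b20 c20 dd.
(* Cauchy-Schwarz gives [d^2 <= be2 ga2]; then compare geometric and arithmetic means. *)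
have : d <= (be2 + ga2) / 2.
  rewrite -ler_sqr ?nnegrE ?divr_ge0 ?addr_ge0 //.
  by have := sqr_ge0 (be2 - ga2); nra.
(* One half of [al ga] is at most [(al^2 + ga^2) / 4], the other at most [(d + e) / 4]. *)
by have := sqr_ge0 (al - ga); nra.
Qed.

End States.

(** * From single states to numerical radii *)

Theorem theorem3p11 (R : realType) (A : cstarAlgType R) (a : A) :
  (forall f : {linear A -> R[i]^o}, states f ->
     `|f a| ^+ 2 <=
        4^-1 * `|f (modulus a + 'i%C *: modulus (star a))| ^+ 2
      + 4^-1 * `|f (modulus a * modulus (star a))|
      + 8^-1 * f (modulus a ^+ 2 + modulus (star a) ^+ 2))
  /\
  numerical_radius a ^+ 2 <=
      4^-1 * numerical_radius (modulus a + 'i%C *: modulus (star a)) ^+ 2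
    + 4^-1 * numerical_radius (modulus a * modulus (star a))
    + 8^-1 * real_norm (modulus a ^+ 2 + modulus (star a) ^+ 2).
Proof.
split => [f fS|].
  (* The order of [R[i]] only compares numbers with equal imaginary parts, so the last term must be
     shown to be real. *)
  have ss : star (modulus a ^+ 2 + modulus (star a) ^+ 2)
      = modulus a ^+ 2 + modulus (star a) ^+ 2.
    by rewrite !expr2 starD !starM !(psd_star (psd_modulus _)).
  rewrite !(@real_normE _ R[i]^o) (state_realE fS ss).
  have := state_modulus_bound fS a.
  rewrite -lecR rmorphD (rmorphD _ (_ * _)) !(rmorphXn, rmorphM, fmorphV) /= !rmorph_nat.
  by [].
have nr_ge0 (x : A) : 0 <= numerical_radius x.
  rewrite /numerical_radius; have [|] := pselect (has_sup [set real_norm (f x) | f in @states R A]).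
    move=> hs; have [[_ [f fS _]] _] := hs.
    by apply: (le_trans (real_norm_ge0 (f x))); apply: sup_upper_bound => //; exists f.
  by move/sup_out ->.
have nr_le (x : A) (f : {linear A -> R[i]^o}) : states f -> real_norm (f x) <= numerical_radius x.
  move=> fS; apply: sup_upper_bound; last by exists f.
  split; first by exists (real_norm (f x)); exists f.
  by exists (real_norm x) => _ [g gS <-]; apply: state_le.
set K := _ + _.
have K0 : 0 <= K.
  by rewrite !addr_ge0 // mulr_ge0 ?invr_ge0 ?exprn_ge0 ?real_norm_ge0.
(* With the square root taken, the bound applies to each [|f(a)|] and passes to the supremum. *)
have : numerical_radius a <= Num.sqrt K.
  rewrite {1}/numerical_radius.
  (* Without states the radius is the [sup] of the empty set, which is 0. *)
  have [[f fS]|nS] := pselect (@states R A !=set0); last first.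
    rewrite sup_out ?sqrtr_ge0 // => -[[_ [f fS _]] _].
    by apply: nS; exists f.
  apply: sup_le_ub; first by exists (real_norm (f a)); exists f.
  move=> _ [g gS <-]; rewrite -(ger0_norm (real_norm_ge0 (g a))) -sqrtr_sqr ler_wsqrtr //.
  apply: (le_trans (state_modulus_bound gS a)).
  apply: lerD; first apply: lerD.
  - by rewrite ler_wpM2l ?invr_ge0 // lerXn2r ?nnegrE ?real_norm_ge0 ?nr_ge0 ?nr_le.
  - by rewrite ler_wpM2l ?invr_ge0 // nr_le.
  - rewrite ler_wpM2l ?invr_ge0 //.
    by apply: (le_trans _ (state_le gS _)); apply: (le_trans (ler_norm _) (Re_le_real_norm _)).
rewrite -ler_sqr ?nnegrE ?sqrtr_ge0 ?nr_ge0 //.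
by rewrite sqr_sqrtr.
Qed.
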